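(* Let $k,\ell$ be positive integers. Then $$\mathcal{D}(P_k\,\square\,P_\ell,\mathcal{T})>\frac{k\ell}{8}-\frac{\max\{k,\ell\}}{8}-\min\{k,\ell\}.$$ That is, for every labeling $f$ of the edges of $P_k\,\square\,P_\ell$ by $\{-1,1\}$ there is a (not necessarily spanning) subtree $T$ of $P_k\,\square\,P_\ell$ with $\left|\sum_{e\in E(T)}f(e)\right|>k\ell/8-\max\{k,\ell\}/8-\min\{k,\ell\}$.
   Context: $P_k$ is the path on $k$ vertices and $\square$ is the Cartesian product of graphs, so $P_k\,\square\,P_\ell$ is the $k\times\ell$ grid graph. For a graph $G$, a family $\mathcal{S}_G$ of subgraphs of $G$ and $f:E(G)\to\{-1,1\}$, put $f(S)=\sum_{e\in E(S)}f(e)$ for $S\in\mathcal{S}_G$; the discrepancy is $\mathcal{D}(G,\mathcal{S}_G)=\min_f\max_{S\in\mathcal{S}_G}|f(S)|$, the minimum being over all $f:E(G)\to\{-1,1\}$. $\mathcal{T}$ is the set of all (not necessarily spanning) trees that are subgraphs of $G$; a single vertex counts as a tree. *)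

(* Defs.v *)
From HB Require Import structures.
From mathcomp Require Import all_boot all_order all_algebra.
Set Implicit Arguments.
Unset Strict Implicit.
Unset Printing Implicit Defensive.
Import Order.TTheory GRing.Theory Num.Theory.

Record sgraph := SGraph {
  vertex :> finType;
  adj : rel vertex;
  adj_sym : symmetric adj;
  adj_irr : irreflexive adj }.

Definition edges (G : sgraph) : {set {set G}} :=
  [set [set p.1; p.2] | p in [pred p : G * G | adj p.1 p.2]].

Definition edge (G : sgraph) := {e : {set G} | e \in edges G}.

Lemma path_adj_sym k : symmetric (fun i j : 'I_k => (i.+1 == j) || (j.+1 == i)).
Proof. by move=> i j; rewrite orbC. Qed.

Lemma path_adj_irr k : irreflexive (fun i j : 'I_k => (i.+1 == j) || (j.+1 == i)).
Proof. by move=> i; rewrite orbb gtn_eqF. Qed.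

Definition path_graph (k : nat) : sgraph :=
  SGraph (@path_adj_sym k) (@path_adj_irr k).

Definition cart_adj (G H : sgraph) : rel (G * H) := fun u v =>
  (u.1 == v.1) && adj u.2 v.2 || (u.2 == v.2) && adj u.1 v.1.

Lemma cart_adj_sym G H : symmetric (@cart_adj G H).
Proof.
by move=> u v; rewrite /cart_adj (eq_sym u.1) (eq_sym u.2) (adj_sym u.2) (adj_sym u.1).
Qed.

Lemma cart_adj_irr G H : irreflexive (@cart_adj G H).
Proof. by move=> u; rewrite /cart_adj !adj_irr !andbF. Qed.

Definition cart_prod (G H : sgraph) : sgraph :=
  SGraph (@cart_adj_sym G H) (@cart_adj_irr G H).

Definition is_subgraph (G : sgraph) (S : {set G} * {set {set G}}) : bool :=
  (S.2 \subset edges G) && [forall e in S.2, e \subset S.1].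

Definition subgraph (G : sgraph) :=
  {S : {set G} * {set {set G}} | is_subgraph S}.

Definition sg_vertices (G : sgraph) (S : subgraph G) : {set G} := (val S).1.
Definition sg_edges (G : sgraph) (S : subgraph G) : {set {set G}} := (val S).2.

(* Elements of [sg_edges S] are two-element sets, so this is irreflexive. *)
Definition sg_adj (G : sgraph) (S : subgraph G) : rel G :=
  fun x y => [set x; y] \in sg_edges S.

Definition sg_connected (G : sgraph) (S : subgraph G) : bool :=
  (sg_vertices S != set0) &&
  [forall x in sg_vertices S, forall y in sg_vertices S, connect (sg_adj S) x y].

(* A cycle has pairwise distinct vertices, so bounding its length by #|G| only
   serves to make the predicate boolean; see [sg_acyclicP]. *)
Definition sg_acyclic (G : sgraph) (S : subgraph G) : bool :=
  [forall n : 'I_#|G|.+1, forall c : n.-tuple G,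
     (2 < n) ==> ~~ ucycleb (sg_adj S) c].

Lemma sg_acyclicP (G : sgraph) (S : subgraph G) :
  reflect (forall c : seq G, 2 < size c -> ~ ucycle (sg_adj S) c)
          (sg_acyclic S).
Proof.
apply: (iffP forallP) => [H c c2 cyc|H n].
  have cn : size c < #|G|.+1.
    by case/andP: cyc => _ /card_uniqP <-; rewrite ltnS max_card.
  by have /forallP/(_ (in_tuple c))/implyP/(_ c2)/negP[] := H (Ordinal cn).
apply/forallP=> c; apply/implyP => n2; apply/negP; apply: H.
by rewrite size_tuple.
Qed.

Definition is_tree (G : sgraph) (S : subgraph G) : bool :=
  sg_connected S && sg_acyclic S.

Definition trees (G : sgraph) : {set subgraph G} := [set S | is_tree S].

Definition labeling (G : sgraph) := {ffun edge G -> seq_sub [:: -1; 1 : int]%R}.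

Definition label_sum (G : sgraph) (f : labeling G) (S : subgraph G) : int :=
  (\sum_(e : edge G | val e \in sg_edges S) val (f e))%R.

Definition max_abs_sum (G : sgraph) (F : {set subgraph G}) (f : labeling G) : nat :=
  \max_(S in F) `|label_sum f S|%N.

Definition label0 (G : sgraph) : labeling G := [ffun=> SeqSub (mem_head _ _)].

(* The labeling [label0] only witnesses that labelings exist. *)
Definition discrepancy (G : sgraph) (F : {set subgraph G}) : nat :=
  max_abs_sum F [arg min_(f < label0 G) max_abs_sum F f].

Lemma discrepancyP (G : sgraph) (F : {set subgraph G}) :
  (exists f, max_abs_sum F f = discrepancy F) /\
  (forall f, discrepancy F <= max_abs_sum F f).
Proof.
split; first by eexists.
by rewrite /discrepancy; case: arg_minnP => // f _ H g; apply: H.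
Qed.

(* Main.v *)
Require Import Defs.
From mathcomp Require Import all_boot all_order all_algebra.
From mathcomp Require Import zify lra.
Import Order.TTheory GRing.Theory Num.Theory.

Set Implicit Arguments.
Unset Strict Implicit.

(** Let [T] be a spanning tree with a set [L] of leaves.  Deleting from [T] the
    leaves of [L] whose edge is labelled [-1] gives a tree [T+], deleting those
    whose edge is labelled [1] gives a tree [T-], and [f(T+) - f(T-) = |L|]
    because the rest of [T] cancels; hence one of the two trees has discrepancy
    at least [|L|/2].  In the grid, the comb made of column 0 and all rows
    of even index, with the vertices of the odd rows hanging from the rows above,
    has [(k %/ 2) * (l - 1)] such leaves. *)

(** * Trees described by a parent map *)

Section RootedTree.

Variables (G : sgraph) (r : G) (par : G -> G) (h : G -> nat).
Hypothesis par_adj : forall v, v != r -> adj v (par v).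
Hypothesis par_lt : forall v, v != r -> h (par v) < h v.

Let up_edge (v : G) : {set G} := [set v; par v].

(** If two distinct vertices had the same upward edge, each would be the parent of the other,
    against the decrease of [h] along [par]. *)
Lemma up_edge_inj : {in predC1 r &, injective up_edge}.
Proof.
move=> u v ur vr /setP E.
have := E u; have := E v.
rewrite !inE !eqxx /= => /orP[/eqP //|/eqP vE] /esym/orP[/eqP //|/eqP uE].
have := par_lt ur; have := par_lt vr; rewrite -vE -uE => h1 h2.
by have := ltn_trans h1 h2; rewrite ltnn.
Qed.

Variable W : {set G}.
Hypothesis rW : r \in W.
Hypothesis parW : forall v, v \in W -> v != r -> par v \in W.

(** The vertex set [W] stays a parameter, so that one parent map yields both pruned trees. *)
Let upper : {set G} * {set {set G}} := (W, up_edge @: (W :\ r)).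

Lemma rooted_subproof : is_subgraph upper.
Proof.
apply/andP; split.
  apply/subsetP => _ /imsetP[v /setD1P[vr vW] ->].
  by apply/imsetP; exists (v, par v); rewrite // inE par_adj.
apply/forall_inP => _ /imsetP[v /setD1P[vr vW] ->].
by apply/subsetP => x; rewrite !inE => /orP[] /eqP->; rewrite ?parW.
Qed.

Definition rooted_subgraph : subgraph G := exist _ upper rooted_subproof.

Lemma rooted_adjP x y : sg_adj rooted_subgraph x y ->
  (x != r /\ y = par x) \/ (y != r /\ x = par y).
Proof.
case/imsetP => v /setD1P[vr vW] /setP E.
have := E v; have := E (par v); have := E x; have := E y.
rewrite !inE !eqxx !orbT /=.
move=> /esym /orP[]/eqP yE /esym /orP[]/eqP xE; subst.
- by move=> /orP[]/eqP pv _; have := par_lt vr; rewrite pv ltnn.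
- by right.
- by left.
- by move=> _ /orP[]/eqP pv; have := par_lt vr; rewrite -pv ltnn.
Qed.

Lemma rooted_adj_par v : v \in W -> v != r -> sg_adj rooted_subgraph v (par v).
Proof. by move=> vW vr; apply/imsetP; exists v; rewrite // !inE vr. Qed.

Lemma sg_adj_sym (S : subgraph G) : symmetric (sg_adj S).
Proof. by move=> x y; rewrite /sg_adj setUC. Qed.

Lemma rooted_connect v : v \in W -> connect (sg_adj rooted_subgraph) v r.
Proof.
have [n] := ubnP (h v); elim: n v => // n IH v /ltnSE hv vW.
have [-> //|vr] := eqVneq v r.
apply: (connect_trans (connect1 (rooted_adj_par _ _))) => //.
by apply: IH; rewrite ?parW // (leq_trans (par_lt vr)).
Qed.

Lemma rooted_is_tree : is_tree rooted_subgraph.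
Proof.
apply/andP; split.
  apply/andP; split; first by apply/set0Pn; exists r.
  apply/forall_inP => x xW; apply/forall_inP => y yW.
  apply: (connect_trans (rooted_connect xW)).
  rewrite sym_connect_sym; [exact: rooted_connect | exact: sg_adj_sym].
apply/sg_acyclicP => c c2 /andP[cyc Uc].
(* The two cyclic neighbours of a highest vertex would both be its parent. *)
have [v vc vmax] : exists2 v, v \in c & forall u, u \in c -> h u <= h v.
  case: c c2 cyc Uc => // x0 c _ _ _.
  case: (@arg_maxnP _ x0 (mem (x0 :: c)) h (mem_head _ _)) => v vc vm.
  by exists v.
have nbr u : u \in c -> sg_adj rooted_subgraph v u -> u = par v.
  move=> uc /rooted_adjP[[]//|[ur vE]].
  by have := par_lt ur; rewrite -vE ltnNge vmax.
have nE := nbr _ (etrans (mem_next c v) vc) (next_cycle cyc vc).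
have pE : prev c v = par v.
  by apply: nbr; rewrite ?mem_prev // sg_adj_sym prev_cycle.
(* Two steps forward from [v] return to [v], which is impossible on a cycle with at least three
   distinct vertices. *)
have : next c (next c v) = v by rewrite nE -pE next_prev.
case/rot_to: vc => i c' rE.
have Uc' : uniq (v :: c') by rewrite -rE rot_uniq.
rewrite -(next_rot i Uc v) -(next_rot i Uc) rE.
move: c2; rewrite -(size_rot i) rE.
case: c' Uc' {rE} => [|a [|b c']] //= /and3P[].
rewrite !inE !negb_or => /and3P[va vb _] _ _ _.
by rewrite eqxx (eq_sym a) (negbTE va) eqxx => /eqP; rewrite eq_sym (negbTE vb).
Qed.

(** Extending the labels by 0 to all vertex sets allows sums over edges to be reindexed by
    vertices. *)
Definition edge_label (f : labeling G) (A : {set G}) : int :=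
  if insub A is Some e then val (f e) else 0%R.

(** By injectivity of [up_edge], each non-root vertex of [W] accounts for exactly one edge. *)
Lemma label_sum_rooted (f : labeling G) :
  label_sum f rooted_subgraph =
  (\sum_(v in W :\ r) edge_label f (up_edge v))%R.
Proof.
have -> : label_sum f rooted_subgraph =
    (\sum_(A in edges G | A \in up_edge @: (W :\ r)) edge_label f A)%R.
  rewrite big_sub_cond; apply: eq_bigr => e _.
  by rewrite /edge_label valK.
rewrite (eq_bigl (mem (up_edge @: (W :\ r)))); last first.
  move=> A; rewrite andb_idl //.
  by case/andP: rooted_subproof => /subsetP/(_ A).
rewrite big_imset // => u v; rewrite !inE => /andP[ur _] /andP[vr _].
exact: up_edge_inj.
Qed.

End RootedTree.

(** * Pruning leaves by the sign of their edge *)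

Section Leaves.

Variables (G : sgraph) (r : G) (par : G -> G) (h : G -> nat).
Hypothesis par_adj : forall v, v != r -> adj v (par v).
Hypothesis par_lt : forall v, v != r -> h (par v) < h v.
Variable L : {set G}.
Hypothesis rL : r \notin L.
Hypothesis parL : forall v, v != r -> par v \notin L.

Lemma edge_label_sign (f : labeling G) v : v != r ->
  (edge_label f [set v; par v] = 1 \/ edge_label f [set v; par v] = -1)%R.
Proof.
move=> vr; have eE : [set v; par v] \in edges G.
  by apply/imsetP; exists (v, par v); rewrite // inE par_adj.
rewrite /edge_label; case: insubP => [e _ _|/negP //].
by have := valP (f e); rewrite !inE => /orP[]/eqP ->; [right|left].
Qed.

Lemma leaves_le_discrepancy : #|L| <= (discrepancy (trees G)).*2.
Proof.
have [[f <-] _] := discrepancyP (trees G).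
pose w v := edge_label f [set v; par v].
(* [W 1] and [W (-1)] are the vertex sets of T+ and T-: everything outside [L], and the leaves whose
   edge has label [s]. *)
pose W (s : int) := [set v | (v \in L) ==> (w v == s)].
have rW s : r \in W s by rewrite inE (negbTE rL).
have parW s v : v \in W s -> v != r -> par v \in W s.
  by move=> _ vr; rewrite inE (negbTE (parL vr)).
pose T s := rooted_subgraph par_adj (parW s).
have le_max s : (`|label_sum f (T s)| <= max_abs_sum (trees G) f)%N.
  apply: (leq_bigmax_cond (F := fun S => `|label_sum f S|%N)).
  by rewrite inE; apply: rooted_is_tree par_lt _ _ _.
have sumT s : label_sum f (T s) =
    (\sum_(v | v != r) (if (v \in L) ==> (w v == s) then w v else 0))%R.
  rewrite (label_sum_rooted par_adj par_lt) big_mkcond [RHS]big_mkcond.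
  by apply: eq_bigr => v _; rewrite !inE; case: (v == r).
have : (label_sum f (T 1) - label_sum f (T (-1)) = #|L|%:Z)%R.
  rewrite !sumT -sumrB -sum1_card -natz natr_sum big_mkcond [RHS]big_mkcond.
  apply: eq_bigr => v _; have [->|vr] /= := eqVneq v r.
    by rewrite (negbTE rL).
  (* Outside [L] the two terms cancel; a leaf contributes 1 - 0 or 0 - (-1), hence 1 in either
     case. *)
  case: (v \in L) => /=; last by rewrite subrr.
  by rewrite /w; case: (edge_label_sign f vr) => ->; rewrite eqxx.
move: (le_max 1%R) (le_max (-1)%R); lia.
Qed.

End Leaves.

(** * The comb in the grid *)

Definition ord_dec n (i : 'I_n) : 'I_n :=
  Ordinal (leq_ltn_trans (leq_pred i) (ltn_ord i)).

Section Grid.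

Variables k l : nat.
Hypotheses (hk : 0 < k) (hl : 0 < l).
Let G := cart_prod (path_graph k) (path_graph l).

Let root : G := (Ordinal hk, Ordinal hl).

(** [ord_dec] fixes 0, but away from the root only a positive coordinate is lowered: in the second
    case the row is odd or the column is 0. *)
Definition comb_par (v : 'I_k * 'I_l) : 'I_k * 'I_l :=
  if (0 < v.2) && ~~ odd v.1 then (v.1, ord_dec v.2) else (ord_dec v.1, v.2).

Definition comb_leaves : {set 'I_k * 'I_l} :=
  setX [set i : 'I_k | odd i] [set j : 'I_l | 0 < j].

Lemma root_neq (v : G) : (v != root) = (0 < v.1 + v.2).
Proof.
case: v => i j; rewrite -[_ == _]/((i == Ordinal hk) && (j == Ordinal hl)).
by rewrite -!val_eqE /= addn_gt0 !lt0n negb_and.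
Qed.

Lemma comb_par_adj (v : G) : v != root -> adj v (comb_par v : G).
Proof.
rewrite root_neq; case: v => i j /= v0.
rewrite /comb_par /cart_adj /=; case: ifP => /= H; rewrite ?eqxx /=; lia.
Qed.

Lemma comb_par_lt (v : G) : v != root ->
  (comb_par v).1 + (comb_par v).2 < v.1 + v.2.
Proof.
rewrite root_neq; case: v => i j /= v0.
by rewrite /comb_par /=; case: ifP => /= H; lia.
Qed.

(** A step to the left stays in an even row; a step up ends in an even row or stays in column 0. *)
Lemma comb_par_leaf (v : G) : v != root -> comb_par v \notin comb_leaves.
Proof.
rewrite root_neq; case: v => i j /= v0.
by rewrite /comb_par /=; case: ifP => /= H; rewrite !inE /=; lia.
Qed.

Lemma card_comb_leaves : #|comb_leaves| = k./2 * l.-1.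
Proof.
rewrite cardsX -!sum1dep_card; congr (_ * _).
  elim: k => [|n IH]; first by rewrite big_ord0.
  rewrite big_mkcond big_ord_recr -big_mkcond /= IH; case: ifP; lia.
elim: l hl => // -[|n] IH _.
  by rewrite big_mkcond big_ord_recr big_ord0.
rewrite big_mkcond big_ord_recr -big_mkcond /= IH //; lia.
Qed.

Lemma comb_leaves_bound : k./2 * l.-1 <= (discrepancy (trees G)).*2.
Proof.
rewrite -card_comb_leaves.
apply: (leaves_le_discrepancy comb_par_adj comb_par_lt _ comb_par_leaf).
by rewrite !inE.
Qed.

End Grid.

(** Since [k./2] is at least (k-1)/2, one gets (k-1)(l-1) <= 4d, so kl < 4d + k + l, and k + l is
    the sum of the maximum and the minimum. *)
Lemma comb_leaves_large k l d : 0 < k -> 0 < l -> k./2 * l.-1 <= d.*2 ->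
  k * l < 8 * d + maxn k l + 8 * minn k l.
Proof.
move=> k0 l0 hd; have := odd_double_half k; move: k./2 hd => h hd.
case: (odd k) => /= kE; nia.
Qed.

Unset Implicit Arguments.
Set Strict Implicit.

Theorem corollary1p7 (k l : nat) (hk : 0 < k) (hl : 0 < l) :
  ((k * l)%:R / 8%:R - (maxn k l)%:R / 8%:R - (minn k l)%:R
     < (discrepancy (trees (cart_prod (path_graph k) (path_graph l))))%:R :> rat)%R.
Proof.
have := comb_leaves_large hk hl (comb_leaves_bound hk hl).
move: (discrepancy _) => d; rewrite -(ltr_nat rat) !natrD !natrM; lra.
Qed.
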